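(* Let $M\in\mathcal{P}_d(\mathbb{Z})$ and let $r$ be a non-negative integer. Fix a basis $(e_1,\ldots,e_d)$ of $K^d$, with respect to which $\Lambda(M)$ and $\Lambda(M+rJ_d)$ are formed, and put $$\Lambda_r(M)=\{X\in\Lambda(M+rJ_d)\mid X_{11}\equiv\cdots\equiv X_{dd}\bmod \pi^r\}.$$ Then $$\Lambda_r(M)=\mathbb{B}_r(M)\quad\text{and}\quad Q(\mathbb{B}_r(M))=\mathrm{B}_r(M).$$ In particular, bolytrope orders are closed and bolytropes are $\mathrm{PZ}$-closed.
   Context: $K$ is a (commutative) discretely valued field, not necessarily complete, with valuation ring $\mathcal{O}_K$, uniformizer $\pi$ and maximal ideal $\mathfrak{m}_K=\pi\mathcal{O}_K\neq\{0\}$; $d$ is a positive integer. A lattice in $K^d$ is a free $\mathcal{O}_K$-submodule of rank $d$; $[L]=\{\pi^nL\mid n\in\mathbb{Z}\}$ is its homothety class; $\mathcal{B}_d^0(K)$ is the set of all homothety classes of lattices in $K^d$. An order in $K^{d\times d}=\mathrm{End}_K(K^d)$ is a full-rank free $\mathcal{O}_K$-submodule (rank $d^2$) that is a subring containing the identity. $\mathrm{End}_{\mathcal{O}_K}(L)=\{X\in K^{d\times d}\mid XL\subseteq L\}$ depends only on $[L]$. For an order $\Lambda$, $Q(\Lambda)=\{[L]\in\mathcal{B}_d^0(K)\mid \Lambda L=L\}$. The order $\Lambda$ is closed if $\Lambda=\bigcap_{[L]\in Q(\Lambda)}\mathrm{End}_{\mathcal{O}_K}(L)$. A subset $\mathcal{L}\subseteq\mathcal{B}_d^0(K)$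 is $\mathrm{PZ}$-closed if $\mathcal{L}=Q(\Lambda)$ for some order $\Lambda$. Distance: $\mathrm{dist}([L_1],[L_2])$ is the minimal $s$ such that there are $L_1'\in[L_1]$, $L_2'\in[L_2]$ with $\pi^sL_1'\subseteq L_2'\subseteq L_1'$; $\mathrm{dist}([L],\mathcal{L})=\min_{[L']\in\mathcal{L}}\mathrm{dist}([L],[L'])$. A subset $\mathcal L\subseteq\mathcal{B}_d^0(K)$ is bounded if the pairwise distances of its elements are bounded. For a non-empty bounded $\mathcal{L}$, $\mathrm{PZ}(\mathcal{L})=\bigcap_{[L]\in\mathcal{L}}\mathrm{End}_{\mathcal{O}_K}(L)$ and $\mathrm{B}_r(\mathcal{L})=\{[L]\mid\mathrm{dist}([L],\mathcal{L})\le r\}$. $\mathcal{P}_d(\mathbb{Z})=\{M\in\mathbb{Z}^{d\times d}\mid M_{ii}=0,\ M_{ij}+M_{jk}\ge M_{ik}\text{ for all }i,j,k\}$. $J_d$ is the $d\times d$ matrix with zeros on the diagonal and ones elsewhere. For $M\in\mathcal{P}_d(\mathbb{Z})$, $\Lambda(M)=\{X\in K^{d\times d}\mid X_{ij}\in\mathfrak{m}_K^{M_{ij}}\text{ for all }i,j\}$, matrices being written with respect to a chosen basis $(e_1,\dots,e_d)$ of $K^d$; this is an order. The bolytrope with center $Q(\Lambda(M))$ and radius $r$ is $\mathrm{B}_r(M):=\mathrm{B}_r(Q(\Lambda(M)))$, and the bolytrope order is $\mathbb{B}_r(M):=\mathrm{PZ}(\mathrm{B}_r(M))$. *)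

(* Defs.v *)
From HB Require Import structures.
From mathcomp Require Import all_boot all_order all_algebra.
From mathcomp Require Import boolp classical_sets.

Set Implicit Arguments.
Unset Strict Implicit.
Unset Printing Implicit Defensive.

Import Order.TTheory GRing.Theory Num.Theory.

Local Open Scope classical_set_scope.
Local Open Scope ring_scope.

(* Discrete valuations are normalized, i.e. have value group all of Z.  The
   value at 0, mathematically +oo, is left unspecified: no axiom mentions it,
   and 0 is treated separately wherever valuations are compared. *)
Record discrete_valuation (K : fieldType) := DiscreteValuation {
  valuation :> K -> int;
  valuationM : forall x y : K, x != 0 -> y != 0 ->
    valuation (x * y) = valuation x + valuation y;
  valuationD : forall x y : K, x != 0 -> y != 0 -> x + y != 0 ->
    Num.min (valuation x) (valuation y) <= valuation (x + y);
  valuation_surj : forall n : int, exists2 x : K, x != 0 & valuation x = n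
}.

Definition valuation_ring (K : fieldType) (v : discrete_valuation K) : set K :=
  [set x | x = 0 \/ 0 <= v x].

Definition uniformizer (K : fieldType) (v : discrete_valuation K) (pi : K) :
    Prop :=
  pi != 0 /\ v pi = 1.

(* The fractional ideal pi^n O_K, for n : int of either sign. *)
Definition max_ideal_pow (K : fieldType) (v : discrete_valuation K) (pi : K)
    (n : int) : set K :=
  [set pi ^ n * x | x in valuation_ring v].

Definition free_submodule (K : fieldType) (v : discrete_valuation K)
    (V : lmodType K) (n : nat) (L : set V) : Prop :=
  exists b : 'I_n -> V,
    (forall c : 'I_n -> K, (forall i, valuation_ring v (c i)) ->
       \sum_i c i *: b i = 0 -> forall i, c i = 0) /\
    L = [set x | exists2 c : 'I_n -> K,
                   (forall i, valuation_ring v (c i)) & x = \sum_i c i *: b i].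

Definition lattice (K : fieldType) (v : discrete_valuation K) (d : nat)
    (L : set 'cV[K]_d) : Prop :=
  free_submodule v d L.

Definition scale_set (K : fieldType) (d : nat) (a : K) (L : set 'cV[K]_d) :
    set 'cV[K]_d :=
  [set a *: x | x in L].

Definition homothety_class (K : fieldType) (pi : K) (d : nat)
    (L : set 'cV[K]_d) : set (set 'cV[K]_d) :=
  [set scale_set (pi ^ n) L | n in [set: int]].

Definition building (K : fieldType) (v : discrete_valuation K) (pi : K)
    (d : nat) : set (set (set 'cV[K]_d)) :=
  [set homothety_class pi L | L in [set L | lattice v L]].

Definition is_order (K : fieldType) (v : discrete_valuation K) (d : nat)
    (A : set 'M[K]_d) : Prop :=
  [/\ free_submodule v (d ^ 2) A,
      A 1%:M &
      forall X Y, A X -> A Y -> A (X *m Y)].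

(* The product A L of a set of matrices and a set of vectors: all finite sums
   of products. *)
Definition set_mulmx (K : fieldType) (d : nat) (A : set 'M[K]_d)
    (L : set 'cV[K]_d) : set 'cV[K]_d :=
  [set x | exists n : nat, exists X : 'I_n -> 'M[K]_d,
           exists y : 'I_n -> 'cV[K]_d,
             [/\ forall i, A (X i), forall i, L (y i) &
                 x = \sum_i X i *m y i]].

Definition End_lattice (K : fieldType) (d : nat) (L : set 'cV[K]_d) :
    set 'M[K]_d :=
  [set X | [set X *m x | x in L] `<=` L].

Definition Q (K : fieldType) (v : discrete_valuation K) (pi : K) (d : nat)
    (A : set 'M[K]_d) : set (set (set 'cV[K]_d)) :=
  [set homothety_class pi L | L in [set L | lattice v L /\ set_mulmx A L = L]].

Definition PZ (K : fieldType) (v : discrete_valuation K) (pi : K) (d : nat)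
    (C : set (set (set 'cV[K]_d))) : set 'M[K]_d :=
  \bigcap_(L in [set L | lattice v L /\ C (homothety_class pi L)])
    End_lattice L.

Definition closed_order (K : fieldType) (v : discrete_valuation K) (pi : K)
    (d : nat) (A : set 'M[K]_d) : Prop :=
  is_order v A /\ A = PZ v pi (Q v pi A).

Definition PZ_closed (K : fieldType) (v : discrete_valuation K) (pi : K)
    (d : nat) (C : set (set (set 'cV[K]_d))) : Prop :=
  exists2 A : set 'M[K]_d, is_order v A & C = Q v pi A.

(* The least element of A, with the dummy value 0 if A is empty. *)
Definition min_nat (A : set nat) : nat :=
  xget 0%N [set n | A n /\ forall m, A m -> (n <= m)%N].

(* The exponent s may range over nat only: for d > 0, the inclusions below are
   impossible with a negative exponent. *)
Definition dist (K : fieldType) (pi : K) (d : nat)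
    (c1 c2 : set (set 'cV[K]_d)) : nat :=
  min_nat [set s | exists L1 L2,
    [/\ c1 L1, c2 L2, scale_set (pi ^+ s) L1 `<=` L2 & L2 `<=` L1]].

Definition dist_set (K : fieldType) (pi : K) (d : nat)
    (c : set (set 'cV[K]_d)) (C : set (set (set 'cV[K]_d))) : nat :=
  min_nat [set dist pi c c' | c' in C].

(* Meaningful for nonempty C only, see min_nat. *)
Definition ball (K : fieldType) (v : discrete_valuation K) (pi : K) (d : nat)
    (r : nat) (C : set (set (set 'cV[K]_d))) : set (set (set 'cV[K]_d)) :=
  [set c | building v pi c /\ (dist_set pi c C <= r)%N].

Definition polytrope_matrix (d : nat) (M : 'M[int]_d) : Prop :=
  (forall i, M i i = 0) /\ (forall i j k, M i k <= M i j + M j k).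

Definition J (d : nat) : 'M[int]_d := \matrix_(i, j) (i != j)%:R.

(* The matrix in the basis e of the endomorphism x |-> X *m x of K^d. *)
Definition mx_in_basis (K : fieldType) (d : nat) (e : d.-tuple 'cV[K]_d)
    (X : 'M[K]_d) : 'M[K]_d :=
  \matrix_(i, j) coord e i (X *m tnth e j).

Definition Lambda (K : fieldType) (v : discrete_valuation K) (pi : K)
    (d : nat) (e : d.-tuple 'cV[K]_d) (M : 'M[int]_d) : set 'M[K]_d :=
  [set X | forall i j, max_ideal_pow v pi (M i j) (mx_in_basis e X i j)].

Definition Lambda_r (K : fieldType) (v : discrete_valuation K) (pi : K)
    (d : nat) (e : d.-tuple 'cV[K]_d) (M : 'M[int]_d) (r : nat) :
    set 'M[K]_d :=
  [set X | Lambda v pi e (M + r%:Z *: J d) X /\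
     forall i j,
       max_ideal_pow v pi r%:Z (mx_in_basis e X i i - mx_in_basis e X j j)].

Definition bolytrope (K : fieldType) (v : discrete_valuation K) (pi : K)
    (d : nat) (e : d.-tuple 'cV[K]_d) (M : 'M[int]_d) (r : nat) :
    set (set (set 'cV[K]_d)) :=
  ball v pi r (Q v pi (Lambda v pi e M)).

Definition bolytrope_order (K : fieldType) (v : discrete_valuation K) (pi : K)
    (d : nat) (e : d.-tuple 'cV[K]_d) (M : 'M[int]_d) (r : nat) :
    set 'M[K]_d :=
  PZ v pi (bolytrope v pi e M r).

(* Main.v *)
(* Two descriptions drive the proof: Lambda_r(M) = O_K + pi^r Lambda(M), and
   [L] lies in the bolytrope iff L <= L' and pi^r L' <= L for some Lambda(M)-stable
   lattice L'.  So Lambda_r(M) stabilizes the bolytrope.  Conversely, a matrix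
   stabilizing the lattices O_K w + pi^r L_j, with L_j the lattice spanned by
   the pi^(M_ij) e_i, lies in Lambda_r(M): w = e_j yields the conditions on
   column j, and w = sum_i pi^(M_ij) e_i the congruences of the diagonal
   entries.  Finally, if L is stable under Lambda_r(M), then L' = Lambda(M) L is
   a witness for [L] being in the bolytrope; it is a lattice because the
   diagonal idempotents of Lambda(M) split it into fractional ideals. *)

Require Import Defs.
From HB Require Import structures.
From mathcomp Require Import all_boot all_order all_algebra.
From mathcomp Require Import boolp classical_sets.
From mathcomp Require Import ring zify.

Set Implicit Arguments.
Unset Strict Implicit.
Unset Printing Implicit Defensive.

Import Order.TTheory GRing.Theory Num.Theory.

Local Open Scope classical_set_scope.
Local Open Scope ring_scope.

(** Nonemptiness excludes the dummy value 0, so well-ordering of the naturals gives a true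
    minimum. *)
Lemma min_natP (A : set nat) : A !=set0 ->
  A (min_nat A) /\ forall m, A m -> (min_nat A <= m)%N.
Proof.
case=> n0 An0; rewrite /min_nat.
have ex : exists n, `[< A n >] by exists n0; apply/asboolP.
case: (ex_minnP ex) => m /asboolP Am minm.
apply: (@xgetPex _ 0%N [set n | A n /\ forall m, A m -> (n <= m)%N]).
exists m; split=> // k Ak.
by apply: minm; apply/asboolP.
Qed.

(** * Valuations and fractional ideals *)

Section Valuation.
Variables (K : fieldType) (v : discrete_valuation K).

Lemma valuation1 : v 1 = 0.
Proof.
have := valuationM v (oner_neq0 K) (oner_neq0 K).
by rewrite mulr1 => /eqP; rewrite -subr_eq0 opprD addNKr oppr_eq0 => /eqP.
Qed.

Lemma valuationV x : x != 0 -> v x^-1 = - v x.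
Proof.
move=> x0; apply/eqP; rewrite -subr_eq0 opprK -valuationM ?invr_eq0//.
by rewrite mulVf// valuation1.
Qed.

Lemma valuationN x : v (- x) = v x.
Proof.
have [->|x0] := eqVneq x 0; first by rewrite oppr0.
have m0 : (-1 : K) != 0 by rewrite oppr_eq0 oner_neq0.
have := valuationM v m0 m0; rewrite mulrNN mulr1 valuation1 => h.
have {}h : v (-1) = 0 by lia.
by rewrite -mulN1r valuationM// h add0r.
Qed.

Variables (pi : K) (hpi : uniformizer v pi).

Lemma uniformizer_neq0 (n : int) : pi ^ n != 0.
Proof. by case: hpi => pi0 _; rewrite expfz_neq0. Qed.

Lemma valuation_pi (n : int) : v (pi ^ n) = n.
Proof.
have vn (k : nat) : v (pi ^+ k) = k.
  elim: k => [|k IH]; first by rewrite expr0 valuation1.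
  case: hpi => pi0 vpi; rewrite exprS valuationM ?expf_neq0// vpi IH; lia.
case: n => k; first exact: vn.
by rewrite NegzE -exprnN valuationV ?vn// expf_neq0//; case: hpi.
Qed.

Local Notation I := (max_ideal_pow v pi).

(** The value [v 0] is unspecified, hence the separate alternative for zero. *)
Lemma max_ideal_powE n x : I n x <-> x = 0 \/ n <= v x.
Proof.
split=> [[y Oy <-]|].
  have [->|y0] := eqVneq y 0; first by left; rewrite mulr0.
  right; rewrite valuationM ?uniformizer_neq0// valuation_pi.
  case: Oy => [y00|]; first by rewrite y00 eqxx in y0.
  lia.
case=> [->|nx]; first by exists 0; [left|rewrite mulr0].
have [->|x0] := eqVneq x 0; first by exists 0; [left|rewrite mulr0].
exists (pi ^ (- n) * x).
  right; rewrite valuationM ?uniformizer_neq0// valuation_pi; lia.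
by rewrite mulrA -expfzDr ?subrr ?mul1r//; case: hpi.
Qed.

Lemma valuation_ringE x : valuation_ring v x <-> I 0 x.
Proof. by rewrite max_ideal_powE. Qed.

Lemma max_ideal_pow0 n : I n 0.
Proof. by apply/max_ideal_powE; left. Qed.

Lemma max_ideal_powD n x y : I n x -> I n y -> I n (x + y).
Proof.
have [->|x0] := eqVneq x 0; first by rewrite add0r.
have [->|y0] := eqVneq y 0; first by rewrite addr0.
have [->|xy0] := eqVneq (x + y) 0; first by move=> *; exact: max_ideal_pow0.
move=> /max_ideal_powE[/eqP|nx]; first by rewrite (negPf x0).
move=> /max_ideal_powE[/eqP|ny]; first by rewrite (negPf y0).
apply/max_ideal_powE; right; have := valuationD v x0 y0 xy0.
by apply: le_trans; rewrite le_min nx ny.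
Qed.

Lemma max_ideal_powN n x : I n x -> I n (- x).
Proof.
move=> /max_ideal_powE[->|nx]; first by rewrite oppr0; exact: max_ideal_pow0.
by apply/max_ideal_powE; right; rewrite valuationN.
Qed.

Lemma max_ideal_powB n x y : I n x -> I n y -> I n (x - y).
Proof. by move=> nx ny; apply: max_ideal_powD => //; exact: max_ideal_powN. Qed.

Lemma max_ideal_powM m n x y : I m x -> I n y -> I (m + n) (x * y).
Proof.
have [->|x0] := eqVneq x 0; first by rewrite mul0r => *; exact: max_ideal_pow0.
have [->|y0] := eqVneq y 0; first by rewrite mulr0 => *; exact: max_ideal_pow0.
move=> /max_ideal_powE[/eqP|nx]; first by rewrite (negPf x0).
move=> /max_ideal_powE[/eqP|ny]; first by rewrite (negPf y0).
by apply/max_ideal_powE; right; rewrite valuationM// lerD.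
Qed.

Lemma max_ideal_pow_le m n x : m <= n -> I n x -> I m x.
Proof.
move=> mn /max_ideal_powE[->|nx]; first exact: max_ideal_pow0.
by apply/max_ideal_powE; right; exact: le_trans nx.
Qed.

Lemma max_ideal_pow_pi n : I n (pi ^ n).
Proof. by apply/max_ideal_powE; right; rewrite valuation_pi. Qed.

Lemma max_ideal_pow_mulpi m n x : I m (pi ^ n * x) <-> I (m - n) x.
Proof.
split=> h.
  have := max_ideal_powM (max_ideal_pow_pi (- n)) h.
  by rewrite mulrA -expfzDr ?addNr ?mul1r 1?addrC//; case: hpi.
by have := max_ideal_powM (max_ideal_pow_pi n) h; rewrite addrC subrK.
Qed.

Lemma max_ideal_pow1 : I 0 1.
Proof. exact: (max_ideal_pow_pi 0). Qed.

Lemma max_ideal_pow_sum n (T : finType) (P : pred T) (F : T -> K) :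
  (forall i, P i -> I n (F i)) -> I n (\sum_(i | P i) F i).
Proof.
by move=> h; apply: (big_ind (I n)) => //;
  [exact: max_ideal_pow0 | exact: max_ideal_powD].
Qed.

Lemma common_denominator (T : finType) (c : T -> K) :
  exists n : nat, forall i, I (- n%:Z) (c i).
Proof.
(* A crude bound that dominates every [- v (c i)]; it also covers zero entries, whatever [v 0]
   is. *)
exists (\sum_i absz (v (c i)))%N => i.
apply/max_ideal_powE; right.
rewrite (bigD1 i)//=; lia.
Qed.

(** Valuations on [A] are bounded below by [N], so some nonzero element has least valuation, and
    this element divides all elements of at least that valuation. *)
Lemma fractional_ideal_principal (A : set K) (N : int) :
    (forall x y, A x -> A y -> A (x + y)) ->
    (forall a x, valuation_ring v a -> A x -> A (a * x)) ->
    (exists2 x, x != 0 & A x) -> (forall x, A x -> I N x) ->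
  exists u, A = I u.
Proof.
move=> AD AM [x0 x0n0 Ax0] AN.
(* Shifting by [N] makes the valuations natural numbers, so that a least one can be chosen. *)
pose B := [set n : nat | exists2 x, x != 0 & A x /\ v x = N + n%:Z].
have [x AxP] : exists2 x, A x /\ x != 0 & forall y, A y -> y != 0 -> v x <= v y.
  have AN' y : A y -> y != 0 -> N <= v y.
    by move=> /AN /max_ideal_powE[->|//]; rewrite eqxx.
  have [|[x xn0 [Ax vx]] minB] := @min_natP B.
    exists (absz (v x0 - N)), x0 => //; split=> //; have := AN' _ Ax0 x0n0; lia.
  exists x => // y Ay yn0.
  have vy := AN' _ Ay yn0; have := minB (absz (v y - N)).
  rewrite vx => /(_ _)/wrap[|]; last lia.
  by exists y => //; split=> //; lia.
case: AxP => Ax xn0 minx; exists (v x); apply/seteqP; split=> y.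
  move=> Ay; apply/max_ideal_powE; have [->|yn0] := eqVneq y 0; first by left.
  by right; exact: minx.
move=> Iy; rewrite -(divfK xn0 y); apply: AM => //.
have [->|yn0] := eqVneq y 0; first by left; rewrite mul0r.
case/max_ideal_powE: Iy => [/eqP|]; first by rewrite (negPf yn0).
by right; rewrite valuationM ?invr_eq0// valuationV//; lia.
Qed.

End Valuation.

(** Serves to give bases indexed by any finite type, such as pairs of matrix indices. Independence
    is asked over K, which implies independence over O_K. *)
Lemma free_submodule_fin (K : fieldType) (v : discrete_valuation K)
    (V : lmodType K) (T : finType) (n : nat) (b : T -> V) (L : set V) :
  #|T| = n ->
  (forall c : T -> K, \sum_i c i *: b i = 0 -> forall i, c i = 0) ->
  (forall x, L x <-> exists2 c : T -> K,
     (forall i, valuation_ring v (c i)) & x = \sum_i c i *: b i) ->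
  free_submodule v n L.
Proof.
move=> <- indep LE; exists (b \o enum_val); split=> [c _ c0 i|].
  pose c' := c \o enum_rank.
  have -> : c i = c' (enum_val i) by rewrite /c' /= enum_valK.
  apply: indep; rewrite (reindex_onto enum_val enum_rank)/=; last first.
    by move=> j _; rewrite enum_rankK.
  rewrite -[RHS]c0; apply: eq_big => [j|j _]; first by rewrite enum_valK eqxx.
  by rewrite /c' /= enum_valK.
apply/seteqP; split=> x.
  case/LE=> c cO ->; exists (c \o enum_val) => [i|]; first exact: cO.
  rewrite (reindex_onto enum_val enum_rank)/=; last first.
    by move=> j _; rewrite enum_rankK.
  by apply: eq_bigl => j; rewrite enum_valK eqxx.
case=> c cO ->; apply/LE; exists (c \o enum_rank) => [i|]; first exact: cO.
rewrite [RHS](reindex_onto enum_val enum_rank)/=; last first.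
  by move=> j _; rewrite enum_rankK.
apply: eq_big => [j|j _]; first by rewrite enum_valK eqxx.
by rewrite enum_valK.
Qed.

(** * Lattices, homothety classes and distance *)

Section Lattices.
Variables (K : fieldType) (v : discrete_valuation K).
Variables (pi : K) (hpi : uniformizer v pi) (d : nat).
Local Notation I := (max_ideal_pow v pi).
Local Notation O := (valuation_ring v).
Implicit Types (L : set 'cV[K]_d) (P B X : 'M[K]_d).

Lemma sum_scale_col B (c : 'I_d -> K) :
  \sum_i c i *: col i B = B *m \col_i c i.
Proof.
apply/colP => k; rewrite summxE mxE; apply: eq_bigr => i _.
by rewrite !mxE mulrC.
Qed.

(** A lattice is B O_K^d with [B] invertible, so membership becomes integrality of coordinates.
    Invertibility holds because an O_K-basis stays independent over K. *)
Lemma latticeP L : lattice v L <->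
  exists2 B, B \in unitmx &
    forall x, L x <-> forall i, I 0 ((invmx B *m x) i 0).
Proof.
split=> [[b [indep LE]]|[B uB LE]]; last first.
  apply: (@free_submodule_fin _ _ _ _ _ (fun i => col i B)).
  - exact: card_ord.
  - move=> c; rewrite sum_scale_col => /(congr1 (mulmx (invmx B))).
    by rewrite mulKmx// mulmx0 => /colP c0 i; have := c0 i; rewrite !mxE.
  move=> x; rewrite LE; split=> [Ox|[c cO ->] i].
    exists (fun i => (invmx B *m x) i 0).
      by move=> i; apply/(valuation_ringE hpi).
    rewrite sum_scale_col -[LHS](mulKVmx uB); congr (_ *m _).
    by apply/colP => i; rewrite [in RHS]mxE.
  rewrite sum_scale_col mulKmx// mxE; exact/(valuation_ringE hpi).
pose B : 'M[K]_d := \matrix_(i, j) b j i 0.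
have bE i : b i = col i B by apply/colP => k; rewrite !mxE.
have bB (c : 'I_d -> K) : \sum_i c i *: b i = B *m \col_i c i.
  by rewrite -sum_scale_col; apply: eq_bigr => i _; rewrite bE.
have uB : B \in unitmx.
  rewrite -unitmx_tr -row_free_unit -kermx_eq0; apply/eqP/row_matrixP => k.
  rewrite row0; set w := row k _.
  have wB : w *m B^T = 0.
    by rewrite /w -row_mul mulmx_ker row0.
  have {wB} Bw : B *m w^T = 0.
    by rewrite -[B]trmxK -trmx_mul wB trmx0.
  (* Clearing denominators turns a K-linear relation among the columns of [B] into one over O_K,
     which is trivial by freeness. *)
  have [n wn] := common_denominator hpi (fun i => w 0 i).
  apply/rowP => i; rewrite [RHS]mxE.
  have pin0 := uniformizer_neq0 hpi n.
  apply: (mulfI pin0); rewrite mulr0.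
  apply: (indep (fun i => pi ^ n * w 0 i)).
    move=> j; apply/(valuation_ringE hpi)/(max_ideal_pow_mulpi hpi).
    by rewrite sub0r.
  rewrite bB (_ : \col__ _ = pi ^ n *: w^T) -?scalemxAr ?Bw ?scaler0//.
  by apply/colP => j; rewrite !mxE.
exists B => // x; rewrite LE; split=> [[c cO ->] i|Ox].
  rewrite bB mulKmx// mxE; exact/(valuation_ringE hpi).
exists (fun i => (invmx B *m x) i 0).
  by move=> i; apply/(valuation_ringE hpi).
rewrite bB -[LHS](mulKVmx uB); congr (_ *m _).
by apply/colP => i; rewrite [in RHS]mxE.
Qed.

Lemma lattice0 L : lattice v L -> L 0.
Proof.
case/latticeP => B _ LE; apply/LE => i.
by rewrite mulmx0 mxE; exact: max_ideal_pow0.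
Qed.

Lemma latticeD L x y : lattice v L -> L x -> L y -> L (x + y).
Proof.
case/latticeP => B _ LE /LE Lx /LE Ly; apply/LE => i.
by rewrite mulmxDr mxE; apply: max_ideal_powD.
Qed.

Lemma latticeZ L a x : lattice v L -> I 0 a -> L x -> L (a *: x).
Proof.
case/latticeP => B _ LE Oa /LE Lx; apply/LE => i.
by rewrite -scalemxAr mxE -[0]addr0; apply: max_ideal_powM.
Qed.

Lemma lattice_sum L n (F : 'I_n -> 'cV[K]_d) : lattice v L ->
  (forall i, L (F i)) -> L (\sum_i F i).
Proof.
move=> latL LF; apply: (big_ind L) => //; first exact: lattice0.
by move=> x y; exact: latticeD.
Qed.

Lemma scale_setE L (n : int) x :
  scale_set (pi ^ n) L x <-> L (pi ^ (- n) *: x).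
Proof.
have pi0 : pi != 0 by case: hpi.
split=> [[y Ly <-]|Lx].
  by rewrite scalerA -expfzDr// addNr scale1r.
by exists (pi ^ (- n) *: x); rewrite // scalerA -expfzDr// subrr scale1r.
Qed.

Lemma lattice_scale L (n : int) : lattice v L -> lattice v (scale_set (pi ^ n) L).
Proof.
case/latticeP => B uB LE; apply/latticeP; exists (pi ^ n *: B).
  by rewrite unitmxZ// unitfE (uniformizer_neq0 hpi).
move=> x; rewrite scale_setE LE.
by rewrite invmxZ ?unitmxZ ?unitfE ?(uniformizer_neq0 hpi)// -scalemxAl -scalemxAr
  invr_expz.
Qed.

Lemma homothety_class_refl L : homothety_class pi L L.
Proof.
exists 0 => //; apply/seteqP; split=> x; rewrite scale_setE oppr0 scale1r//.
Qed.

Lemma homothety_class_scale L (n : int) :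
  homothety_class pi (scale_set (pi ^ n) L) = homothety_class pi L.
Proof.
have pi0 : pi != 0 by case: hpi.
have scale_scale m k :
    scale_set (pi ^ m) (scale_set (pi ^ k) L) = scale_set (pi ^ (m + k)) L.
  apply/seteqP; split=> x; rewrite !scale_setE scalerA -expfzDr//;
    by rewrite opprD addrC.
apply/seteqP; split=> L' [m _ <-].
  by exists (m + n) => //; rewrite scale_scale.
by exists (m - n) => //; rewrite scale_scale subrK.
Qed.

Lemma homothety_class_eq L L' :
  homothety_class pi L = homothety_class pi L' ->
  exists n : int, L' = scale_set (pi ^ n) L.
Proof.
by move=> h; have := homothety_class_refl L'; rewrite -h => -[n _ <-]; exists n.
Qed.

(** The exponent comes from a common denominator of the entries of the change of basis matrix. *)
Lemma lattice_commensurable L L' : lattice v L -> lattice v L' ->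
  exists n : nat, forall x, L x -> L' (pi ^+ n *: x).
Proof.
case/latticeP => B uB LE /latticeP[B' uB' LE'].
have [n Cn] := common_denominator hpi
  (fun ij : 'I_d * 'I_d => (invmx B' *m B) ij.1 ij.2).
exists n => x /LE Ox; apply/LE' => i.
rewrite -{1}[x](mulKVmx uB) -scalemxAr mxE.
apply/(max_ideal_pow_mulpi hpi _ n); rewrite sub0r (mulmxA (invmx B') B) mxE.
apply: max_ideal_pow_sum => // j _; rewrite -[- n%:Z]addr0.
by apply: max_ideal_powM => //; exact: (Cn (i, j)).
Qed.

Lemma buildingP L : lattice v L -> building v pi (homothety_class pi L).
Proof. by move=> latL; exists L. Qed.

(** For representatives pi^a L and pi^b L', the two inclusions depend only on b - a, so one shift
    [n] replaces both exponents. *)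
Lemma dist_leP L L' r : lattice v L -> lattice v L' ->
  (dist pi (homothety_class pi L) (homothety_class pi L') <= r)%N <->
  exists2 n : int, (forall x, L x -> L' (pi ^ n *: x)) &
                   (forall x, L' x -> L (pi ^ (r%:Z - n) *: x)).
Proof.
have pi0 : pi != 0 by case: hpi.
move=> latL latL'; rewrite /dist; set A := [set s | _].
have AE s : A s <-> exists2 n : int, (forall x, L x -> L' (pi ^ n *: x)) &
                   (forall x, L' x -> L (pi ^ (s%:Z - n) *: x)).
  split=> [[_ [_ [[a _ <-] [b _ <-] sub1 sub2]]]|[n LL' L'L]].
    exists (a + s%:Z - b) => x Lx.
      have : scale_set (pi ^ b) L' (pi ^+ s *: (pi ^ a *: x)).
        by apply: sub1; exists (pi ^ a *: x) => //; exists x.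
      rewrite scale_setE exprnP !scalerA -!expfzDr//.
      by congr (L' (pi ^ _ *: _)); ring.
    have : scale_set (pi ^ a) L (pi ^ b *: x) by apply: sub2; exists x.
    rewrite scale_setE !scalerA -!expfzDr//.
    by congr (L (pi ^ _ *: _)); ring.
  exists L, (scale_set (pi ^ (s%:Z - n)) L'); split.
  - exact: homothety_class_refl.
  - by exists (s%:Z - n).
  - move=> _ [x Lx <-]; rewrite scale_setE exprnP scalerA -expfzDr//.
    by rewrite opprB subrK; exact: LL'.
  - by move=> _ [x L'x <-]; exact: L'L.
(* Commensurability in both directions makes [A] nonempty, so the minimum is attained. *)
have [m hm] := lattice_commensurable latL latL'.
have [k hk] := lattice_commensurable latL' latL.
have [|AA minA] := @min_natP A.
  exists (m + k)%N; apply/AE; exists m%:Z => //.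
  by rewrite PoszD addrAC subrr add0r.
rewrite -AE; split=> [le_r|]; last exact: minA.
apply/AE; case/AE: AA => n LL' L'L; exists n => // x L'x.
(* The surplus of [r] over the distance is a scaling by an integral power of pi, harmless for a
   lattice. *)
have -> : r%:Z - n = (r - min_nat A)%N%:Z + ((min_nat A)%:Z - n) by lia.
rewrite expfzDr// -scalerA; apply: latticeZ => //; last exact: L'L.
by apply: max_ideal_pow_le (max_ideal_pow_pi hpi _).
Qed.

(** The distance to [C] is attained at some class; rescaling its representative by pi^(-n) absorbs
    the shift [n] of [dist_leP]. *)
Lemma ballP (r : nat) (C : set (set (set 'cV[K]_d))) L :
    C `<=` @building K v pi d -> C !=set0 -> lattice v L ->
  ball v pi r C (homothety_class pi L) <->
  exists L', [/\ lattice v L', C (homothety_class pi L'), L `<=` L' &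
                 forall x, L' x -> L (pi ^+ r *: x)].
Proof.
have pi0 : pi != 0 by case: hpi.
move=> subC C0 latL; rewrite /ball /= /dist_set; set A := image _ _.
have [|AA minA] := @min_natP A; first by case: C0 => c Cc; exists (dist pi
  (homothety_class pi L) c); exists c.
split=> [[_ le_r]|[L' [latL' CL' LL' L'L]]].
  case: AA => c' Cc' dE; have [L' latL' L'E] := subC _ Cc'.
  move: le_r; rewrite -dE -L'E => /(dist_leP _ latL latL')[n LL' L'L].
  exists (scale_set (pi ^ (- n)) L'); split.
  - exact: lattice_scale.
  - by rewrite homothety_class_scale L'E.
  - by move=> x /LL'; rewrite scale_setE opprK.
  - move=> x; rewrite scale_setE opprK => /L'L.
    by rewrite scalerA -expfzDr// subrK.
split; first exact: buildingP.
apply: leq_trans (minA _ (ex_intro2 _ _ _ CL' erefl)) _.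
apply/(dist_leP _ latL latL'); exists 0 => x; first by rewrite scale1r; exact: LL'.
by rewrite subr0; exact: L'L.
Qed.

(** The columns of [P], scaled by the [pi ^ u i], form a basis; the diagonal matrix [D] does the
    scaling. *)
Lemma lattice_diag P (u : 'I_d -> int) : P \in unitmx ->
  lattice v [set x | forall i, I (u i) ((invmx P *m x) i 0)].
Proof.
move=> uP; apply/latticeP.
pose D : 'M[K]_d := diag_mx (\row_i pi ^ u i).
pose D' : 'M[K]_d := diag_mx (\row_i pi ^ (- u i)).
have D'D : D' *m D = 1%:M.
  rewrite mulmx_diag -diag_const_mx; congr diag_mx; apply/rowP => i.
  by rewrite !mxE -expfzDr ?addNr//; case: hpi.
have [uD' uD] := mulmx1_unit D'D.
have uPD : P *m D \in unitmx by rewrite unitmx_mul uP.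
exists (P *m D) => // x; have -> : invmx (P *m D) = D' *m invmx P.
  by rewrite -[RHS](mulmxK uPD) mulmxA mulmxKV// D'D mul1mx.
split=> h i; have := h i; rewrite -mulmxA mul_diag_mx !mxE.
  by move=> ?; apply/(max_ideal_pow_mulpi hpi); rewrite sub0r opprK.
by move=> /(max_ideal_pow_mulpi hpi); rewrite sub0r opprK.
Qed.

End Lattices.

Lemma scalemxE (R : nzRingType) m n (a : R) (A : 'M[R]_(m, n)) i j :
  (a *: A) i j = a * A i j.
Proof. by rewrite mxE. Qed.

(** * Stable lattices, endomorphism rings and coordinates *)

Section Orders.
Variables (K : fieldType) (v : discrete_valuation K).
Variables (pi : K) (hpi : uniformizer v pi) (d : nat).
Local Notation I := (max_ideal_pow v pi).
Implicit Types (L : set 'cV[K]_d) (A : set 'M[K]_d) (X : 'M[K]_d).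

(** Since [A] contains 1, A L = L amounts to A L <= L. Scalars commute with matrices, so the
    condition does not depend on the representative of the class. *)
Lemma QP A L : A 1%:M -> lattice v L ->
  Q v pi A (homothety_class pi L) <->
  forall X x, A X -> L x -> L (X *m x).
Proof.
move=> A1 latL; split=> [[L0 [latL0 AL0]]|AL].
  case/(homothety_class_eq hpi) => n -> X x AX; rewrite !(scale_setE hpi) => L0x.
  rewrite scalemxAr -AL0; exists 1%N, (fun=> X), (fun=> pi ^ (- n) *: x).
  by split=> //; rewrite big_ord1.
exists L => //; split=> //; apply/seteqP; split=> x.
  case=> n [X [y [AX Ly ->]]]; apply: (lattice_sum hpi) => // i.
  exact: AL.
move=> Lx; exists 1%N, (fun=> 1%:M), (fun=> x).
by split=> //; rewrite big_ord1 mul1mx.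
Qed.

Lemma Q_building A : Q v pi A `<=` @building K v pi d.
Proof. by move=> _ [L [latL _] <-]; exact: buildingP. Qed.

Lemma PZP (C : set (set (set 'cV[K]_d))) X :
  PZ v pi C X <-> forall L, lattice v L -> C (homothety_class pi L) ->
                  forall x, L x -> L (X *m x).
Proof.
split=> [PX L latL CL x Lx|PX L [latL CL] _ [x Lx <-]].
  by apply: (PX L) => //; exists x.
exact: PX.
Qed.

Lemma PZ1 (C : set (set (set 'cV[K]_d))) : PZ v pi C 1%:M.
Proof. by apply/PZP => L _ _ x; rewrite mul1mx. Qed.

Lemma PZM (C : set (set (set 'cV[K]_d))) X Y :
  PZ v pi C X -> PZ v pi C Y -> PZ v pi C (X *m Y).
Proof.
move=> /PZP CX /PZP CY; apply/PZP => L latL CL x Lx.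
by rewrite -mulmxA; apply: CX => //; apply: CY.
Qed.

(** Take the basis vectors as columns of [P]; its inverse collects the coordinates of the standard
    unit vectors. From here on, a change of basis is conjugation by [P]. *)
Lemma mx_in_basisE (e : d.-tuple 'cV[K]_d) : basis_of fullv e ->
  exists2 P, P \in unitmx & forall X, mx_in_basis e X = invmx P *m X *m P.
Proof.
move=> he; pose P : 'M[K]_d := \matrix_(i, j) tnth e j i 0.
have PE j : col j P = tnth e j by apply/colP => i; rewrite !mxE.
have coordE y : y = P *m \col_i coord e i y.
  rewrite -sum_scale_col {1}(coord_basis he (memvf y)).
  by apply: eq_bigr => i _; rewrite PE (tnth_nth 0).
have uP : P \in unitmx.
  have [] // := @mulmx1_unit _ _ P (\matrix_(i, j) coord e i (delta_mx j 0)).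
  apply/matrixP => i j; have /colP/(_ i) := coordE (delta_mx j 0).
  rewrite !mxE eqxx andbT => ->; apply: eq_bigr => k _.
  by rewrite !mxE.
exists P => // X; apply/matrixP => i j; rewrite mxE.
have -> : (invmx P *m X *m P) i j = (invmx P *m (X *m col j P)) i 0.
  by rewrite colE !mulmxA -colE [RHS]mxE.
by rewrite PE [in RHS](coordE (X *m _)) mulKmx// mxE.
Qed.

End Orders.

(** * The sets Lambda(M) and Lambda_r(M) in coordinates *)

Section Bolytropes.
Variables (K : fieldType) (v : discrete_valuation K).
Variables (pi : K) (hpi : uniformizer v pi) (d : nat) (d_gt0 : (0 < d)%N).
Variables (e : d.-tuple 'cV[K]_d) (M : 'M[int]_d) (hM : polytrope_matrix M).
Variable (r : nat) (P : 'M[K]_d) (uP : P \in unitmx).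
Hypothesis eP : forall X, mx_in_basis e X = invmx P *m X *m P.
Local Notation I := (max_ideal_pow v pi).
Implicit Types (L : set 'cV[K]_d) (X : 'M[K]_d).
Local Notation conj X := (invmx P *m X *m P).
Local Notation bolytrope := (bolytrope v pi e M r).
Local Notation Lambda_r := (Lambda_r v pi e M r).
Local Notation Lambda := (Lambda v pi e M).
Let i0 : 'I_d := Ordinal d_gt0.

Lemma LambdaE X : Lambda X <-> forall i j, I (M i j) (conj X i j).
Proof. by rewrite /Defs.Lambda /= eP. Qed.

(** Both [J d] and [M] vanish on the diagonal, so adding r J_d changes only the off-diagonal
    conditions. *)
Lemma Lambda_rE X : Lambda_r X <->
  [/\ forall i, I 0 (conj X i i),
      forall i j, i != j -> I (M i j + r%:Z) (conj X i j) &
      forall i j, I r%:Z (conj X i i - conj X j j)].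
Proof.
case: hM => M0 _; rewrite /Defs.Lambda_r /Defs.Lambda /= eP.
split=> [[h1 h2]|[h1 h2 h3]]; split=> // i.
- by have := h1 i i; rewrite !mxE eqxx mulr0 addr0 M0.
- by move=> j ij; have := h1 i j; rewrite [X in I X]mxE [X in _ + X]mxE mxE ij mulr1.
- move=> j; rewrite [X in I X]mxE [X in _ + X]mxE mxE.
  case: eqVneq => [<-|ij]; first by rewrite mulr0 addr0 M0.
  by rewrite mulr1; exact: h2.
Qed.

Lemma conj_mulmx X (x : 'cV[K]_d) :
  invmx P *m (X *m x) = conj X *m (invmx P *m x).
Proof. by rewrite -(mulmxA (_ *m X)) (mulKVmx uP) mulmxA. Qed.

Lemma Lambda1 : Lambda 1%:M.
Proof.
apply/LambdaE => i j; rewrite mulmx1 mulVmx// mxE; case: eqVneq => [<-|_].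
  by rewrite (hM.1 i); exact: max_ideal_pow1.
exact: max_ideal_pow0.
Qed.

Lemma LambdaM X Y : Lambda X -> Lambda Y -> Lambda (X *m Y).
Proof.
move=> /LambdaE LX /LambdaE LY; apply/LambdaE => i j.
have -> : conj (X *m Y) = conj X *m conj Y.
  by rewrite !mulmxA mulmxK.
rewrite mxE; apply: max_ideal_pow_sum => // k _.
by apply: max_ideal_pow_le (hM.2 i k j) _ => //; apply: max_ideal_powM.
Qed.

Lemma Lambda_scalar a : I 0 a -> Lambda a%:M.
Proof.
move=> Oa; apply/LambdaE => i j; rewrite mul_mx_scalar -scalemxAl mulVmx// !mxE.
case: eqVneq => [<-|_]; last by rewrite mulr0; exact: max_ideal_pow0.
by rewrite (hM.1 i) mulr1.
Qed.

(** Gives the summand pi^r Lambda(M) of Lambda_r(M): all diagonal entries become 0 modulo pi^r, and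
    all exponents rise by r. *)
Lemma Lambda_r_scale X : Lambda X -> Lambda_r (pi ^ r *: X).
Proof.
move=> /LambdaE LX; apply/Lambda_rE; rewrite -scalemxAr -scalemxAl.
have LXii i : I 0 (conj X i i) by rewrite -(hM.1 i).
split=> [i|i j _|i j]; rewrite !scalemxE.
- by apply/(max_ideal_pow_mulpi hpi); apply: max_ideal_pow_le (LXii i) => //; lia.
- by apply/(max_ideal_pow_mulpi hpi); rewrite addrK.
- rewrite -mulrBr; apply/(max_ideal_pow_mulpi hpi); rewrite subrr.
  exact: max_ideal_powB.
Qed.

(** All diagonal entries agree modulo pi^r, so subtracting one of them as a scalar matrix leaves a
    matrix from which pi^r can be divided out. *)
Lemma Lambda_r_decomp X : Lambda_r X ->
  exists a Y, [/\ I 0 a, Lambda Y & X = a%:M + pi ^ r *: Y].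
Proof.
move=> /Lambda_rE[X0 Xij Xii]; pose a := conj X i0 i0.
exists a, (pi ^ (- r%:Z) *: (X - a%:M)); split; first exact: X0.
  apply/LambdaE => i j; rewrite -scalemxAr -scalemxAl.
  rewrite mulmxBr mulmxBl mul_mx_scalar -scalemxAl mulVmx// scalemxE.
  have -> : (conj X - a *: 1%:M) i j = conj X i j - a * (i == j)%:R.
    by rewrite [LHS]mxE [X in _ + X = _]mxE scalemxE [1%:M i j]mxE.
  apply/(max_ideal_pow_mulpi hpi); rewrite opprK.
  case: (eqVneq i j) => [<-|ij]; last by rewrite mulr0 subr0; exact: Xij.
  by rewrite (hM.1 i) add0r mulr1; exact: Xii.
by rewrite scalerA -expfzDr ?subrr ?scale1r 1?addrC ?subrK//; case: hpi.
Qed.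

(** * The bolytrope and the matrices that stabilize it *)

Lemma lattice_col k :
  lattice v [set x | forall i, I (M i k) ((invmx P *m x) i 0)].
Proof. exact: lattice_diag. Qed.

(** Stability of the lattice L_k is the triangle inequality for [M]. These lattices show that the
    center is nonempty, so that distances to it are meaningful. *)
Lemma Lambda_col_stable k :
  Q v pi Lambda (homothety_class pi
    [set x | forall i, I (M i k) ((invmx P *m x) i 0)]).
Proof.
apply/(QP hpi); [exact: Lambda1|exact: lattice_col|move=> X x /LambdaE LX Lx i].
rewrite conj_mulmx mxE; apply: max_ideal_pow_sum => // j _.
by apply: max_ideal_pow_le (hM.2 i j k) _ => //; apply: max_ideal_powM.
Qed.

Lemma bolytropeP L : lattice v L ->
  bolytrope (homothety_class pi L) <->
  exists L', [/\ lattice v L', forall X x, Lambda X -> L' x -> L' (X *m x),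
                 L `<=` L' & forall x, L' x -> L (pi ^ r *: x)].
Proof.
move=> latL; have C0 : Q v pi Lambda !=set0.
  by eexists; exact: (Lambda_col_stable i0).
rewrite /Defs.bolytrope (ballP hpi r (@Q_building _ _ _ _ _) C0 latL).
split=> -[L' [latL' QL' sub1 sub2]]; exists L'; split=> //.
  by apply/(QP hpi) => //; exact: Lambda1.
by apply/(QP hpi) => //; exact: Lambda1.
Qed.

(** Write X = a + pi^r Y. The scalar a preserves L, while Y maps L into the stable lattice L', which
    pi^r brings back into L. *)
Lemma Lambda_r_stable X L : Lambda_r X -> lattice v L ->
  bolytrope (homothety_class pi L) -> forall x, L x -> L (X *m x).
Proof.
move=> /Lambda_r_decomp[a [Y [Oa LY ->]]] latL /bolytropeP.
case=> // L' [latL' L'S LL' L'L] x Lx.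
rewrite mulmxDl mul_scalar_mx -scalemxAl; apply: (latticeD hpi) => //.
  exact: (latticeZ hpi).
by apply: L'L; apply: L'S => //; exact: LL'.
Qed.

(* [X] preserves O_K w + pi^r L_j, in the notation of the header, where [t] is
   the coordinate vector of w in the columns of [P]. *)
Lemma PZ_bolytrope_test X j (t : 'cV[K]_d) :
    PZ v pi bolytrope X -> t j 0 = 1 -> (forall i, I (M i j) (t i 0)) ->
  I 0 ((conj X *m t) j 0) /\
  forall i, i != j ->
    I (M i j + r%:Z) ((conj X *m t) i 0 - t i 0 * (conj X *m t) j 0).
Proof.
move=> /PZP PX tj It.
(* As w has j-th coordinate 1, a vector x with j-th coordinate x_j lies in O_K w + pi^r L_j iff x_j
   is integral and x - x_j w lies in pi^r L_j. *)
pose L : set 'cV[K]_d := [set x | I 0 ((invmx P *m x) j 0) /\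
  forall i, i != j ->
    I (M i j + r%:Z) ((invmx P *m x) i 0 - t i 0 * (invmx P *m x) j 0)].
have latL : lattice v L.
  (* The shear [1 + D] sends the j-th unit vector to [t] and fixes the others. As s_j = 0, [D]
     squares to zero and [1 - D] is the inverse. With respect to the columns of [P *m (1 + D)] the
     lattice is diagonal, with exponents [u]. *)
  pose s : 'cV[K]_d := t - delta_mx j 0.
  pose D : 'M[K]_d := s *m delta_mx 0 j.
  have DD : D *m D = 0.
    rewrite /D mulmxA -(mulmxA s) -rowE (_ : row j s = 0) ?mulmx0 ?mul0mx//.
    by apply/rowP => i; rewrite ord1 !mxE tj !eqxx subrr.
  have SD : (1%:M - D) *m (1%:M + D) = 1%:M.
    by rewrite mulmxDr mulmx1 mulmxBl mul1mx DD subr0 subrK.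
  have [uS uS'] := mulmx1_unit SD.
  pose u i := if i == j then 0 else M i j + r%:Z.
  have uPS : P *m (1%:M + D) \in unitmx by rewrite unitmx_mul uP.
  have := lattice_diag hpi u uPS; congr (lattice v _).
  have -> : invmx (P *m (1%:M + D)) = (1%:M - D) *m invmx P.
    by rewrite -[RHS](mulmxK uPS) mulmxA mulmxKV// SD mul1mx.
  have coE x i : ((1%:M - D) *m invmx P *m x) i 0 =
      (invmx P *m x) i 0 - s i 0 * (invmx P *m x) j 0.
    rewrite -mulmxA mulmxBl mul1mx /D -mulmxA -rowE mxE; congr (_ + _).
    by rewrite !mxE big_ord1 !mxE.
  apply/seteqP; split=> x.
    move=> h; split; first by have := h j; rewrite coE /u eqxx !mxE tj !eqxx subrr
      mul0r subr0.
    move=> i ij; have := h i; rewrite coE /u (negPf ij).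
    by rewrite [s i 0]mxE [X in t i 0 + X]mxE [delta_mx _ _ _ _]mxE (negPf ij) subr0.
  case=> h1 h2 i; rewrite coE /u [s i 0]mxE [X in t i 0 + X]mxE [delta_mx _ _ _ _]mxE.
  case: eqVneq => [->|ij]; first by rewrite tj eqxx subrr mul0r subr0.
  by rewrite subr0; exact: h2.
have CL : bolytrope (homothety_class pi L).
  (* The witness is L_j itself: w lies in L_j, hence pi^r L_j <= L <= L_j. *)
  apply/bolytropeP => //; eexists; split; first exact: (lattice_col j).
  - by apply/(QP hpi); [exact: Lambda1|exact: lattice_col|exact: Lambda_col_stable].
  - move=> x [x0 xi] i; have [->|ij] := eqVneq i j; first by rewrite hM.1.
    rewrite -[(invmx P *m x) i 0](subrK (t i 0 * (invmx P *m x) j 0)).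
    apply: max_ideal_powD => //.
      by apply: max_ideal_pow_le (xi i ij) => //; lia.
    by rewrite -[M i j]addr0; apply: max_ideal_powM.
  - move=> x Lx; split=> [|i ij]; rewrite -scalemxAr !scalemxE.
      apply/(max_ideal_pow_mulpi hpi); apply: max_ideal_pow_le (Lx j) => //.
      by rewrite hM.1; lia.
    rewrite mulrCA -mulrBr; apply/(max_ideal_pow_mulpi hpi); rewrite addrK.
    apply: max_ideal_powB => //.
    by rewrite -[M i j]addr0; apply: max_ideal_powM => //; have := Lx j; rewrite hM.1.
(* The conclusion is membership in [L] of the image under [X] of w = [P *m t]. *)
have := PX L latL CL (P *m t); rewrite /L /= (conj_mulmx X) mulKmx//; apply.
rewrite tj; split=> [|i _]; first exact: max_ideal_pow1.
by rewrite mulr1 subrr; exact: max_ideal_pow0.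
Qed.

Lemma bolytrope_orderE : PZ v pi bolytrope = Lambda_r.
Proof.
apply/seteqP; split=> X; last first.
  by move=> LX; apply/PZP => L latL CL; apply: Lambda_r_stable.
move=> PX.
have [Xjj Xij] : (forall j, I 0 (conj X j j)) /\
    forall i j, i != j -> I (M i j + r%:Z) (conj X i j).
  suff h j : I 0 (conj X j j) /\
    forall i, i != j -> I (M i j + r%:Z) (conj X i j).
    by split=> [j|i j]; have [] := h j; last by move=> _; apply.
  (* The test vector w = e_j reads off column j of [X]. *)
  have [||h1 h2] := PZ_bolytrope_test (t := delta_mx j 0) PX (j := j).
  - by rewrite mxE !eqxx.
  - move=> i; rewrite mxE eqxx andbT; case: eqVneq => [->|_].
      by rewrite hM.1; exact: max_ideal_pow1.
    exact: max_ideal_pow0.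
  - move: h1 h2; rewrite -colE mxE => h1 h2; split=> // i ij.
    by have := h2 i ij; rewrite !mxE (negPf ij) mul0r subr0.
apply/Lambda_rE; split=> // i j.
(* The second test vector has the generic coordinates of L_j, so that every diagonal entry is
   compared with the same scalar, the j-th coordinate of the image. *)
pose t : 'cV[K]_d := \col_l pi ^ M l j.
have tj : t j 0 = 1 by rewrite mxE hM.1.
have [|zj zi] := PZ_bolytrope_test PX tj.
  by move=> l; rewrite mxE; exact: max_ideal_pow_pi.
set z := conj X *m t in zj zi.
(* The off-diagonal entries of [X] contribute only beyond exponent [M k j + r], by the triangle
   inequality. *)
have rest k : I (M k j + r%:Z) (z k 0 - conj X k k * t k 0).
  rewrite mxE (bigD1 k)//= addrAC subrr add0r.
  apply: max_ideal_pow_sum => // l lk.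
  have [] := hM => _ /(_ k l j) Mle.
  apply: max_ideal_pow_le (_ : _ <= (M k l + r%:Z) + M l j) _ => //; first lia.
  apply: max_ideal_powM => //; first by apply: Xij; rewrite eq_sym.
  by rewrite mxE; exact: max_ideal_pow_pi.
(* Subtracting [rest] from the test leaves pi^(M_kj) times the wanted difference, in exponent
   [M k j + r]; for [k = j], [rest] alone suffices. *)
have diag k : I r%:Z (conj X k k - z j 0).
  have [->|kj] := eqVneq k j.
    have := rest j; rewrite hM.1 add0r tj mulr1 => /(max_ideal_powN hpi).
    by rewrite opprB.
  have := max_ideal_powB hpi (zi k kj) (rest k).
  have -> : z k 0 - t k 0 * z j 0 - (z k 0 - conj X k k * t k 0) =
      pi ^ M k j * (conj X k k - z j 0) by rewrite [t k 0]mxE; ring.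
  by move=> /(max_ideal_pow_mulpi hpi); rewrite addrAC subrr add0r.
have := max_ideal_powB hpi (diag i) (diag j).
by rewrite opprB addrA subrK.
Qed.

(** * Lattices stable under Lambda_r(M) *)

(** The projection onto the line of the i-th basis vector has a single entry 1, on the diagonal,
    where [M] is 0. *)
Lemma Lambda_proj i : Lambda (P *m delta_mx i i *m invmx P).
Proof.
apply/LambdaE => j k; rewrite !mulmxA mulVmx// mul1mx mulmxKV// mxE.
case: eqVneq => [->|_]; last exact: max_ideal_pow0.
case: eqVneq => [->|_]; last exact: max_ideal_pow0.
by rewrite hM.1; exact: max_ideal_pow1.
Qed.

(* The idempotents of Lambda(M) split L into fractional ideals. *)
Lemma Lambda_stable_lattice L (n m : nat) :
    (forall x y, L x -> L y -> L (x + y)) -> L 0 ->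
    (forall X x, Lambda X -> L x -> L (X *m x)) ->
    (forall i, L (pi ^ n *: col i P)) ->
    (forall x, L x -> forall i, I 0 (pi ^ m * (invmx P *m x) i 0)) ->
  lattice v L.
Proof.
move=> LD L0 LS Ln Lm.
have LZ a x : I 0 a -> L x -> L (a *: x).
  by move=> Oa Lx; rewrite -mul_scalar_mx; apply: LS => //; exact: Lambda_scalar.
have colPE i : invmx P *m col i P = delta_mx i 0.
  by rewrite colE mulKmx.
(* The coefficients a with a e_i in [L] form a fractional ideal, nonzero by [Ln] and bounded by
   [Lm]. *)
have /choice[u uE] i : exists u, [set a | L (a *: col i P)] = I u.
  apply: (@fractional_ideal_principal _ _ _ hpi _ (- m%:Z)) => /=.
  - by move=> a b La Lb; rewrite scalerDl; exact: LD.
  - move=> a b /(valuation_ringE hpi) Oa Lb; rewrite -scalerA; exact: LZ.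
  - by exists (pi ^ n) => //; exact: (uniformizer_neq0 hpi).
  - move=> a /Lm /(_ i); rewrite -scalemxAr colPE !mxE !eqxx mulr1.
    by move=> /(max_ideal_pow_mulpi hpi); rewrite sub0r.
have := lattice_diag hpi u uP; congr (lattice v _).
apply/seteqP; split=> x /= h.
  rewrite -[x](mulKVmx uP).
  have -> : invmx P *m x = \col_i (invmx P *m x) i 0.
    by apply/colP => i; rewrite [RHS]mxE.
  rewrite -sum_scale_col; apply: (big_ind L) => // i _.
  by have := h i; rewrite -uE.
move=> i; rewrite -uE /=.
(* The idempotent extracts the i-th component of [x], which therefore stays in [L]. *)
have := LS _ _ (Lambda_proj i) h; congr L.
rewrite -!mulmxA colE; set y := invmx P *m x.
rewrite scalemxAr; congr (_ *m _).
apply/colP => k; rewrite !mxE (bigD1 i)//= big1 ?addr0 ?mxE ?eqxx ?andbT.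
  by rewrite mulrC.
by move=> l li; rewrite mxE (negPf li) andbF mul0r.
Qed.

(** For L' = Lambda(M) L, the inclusion pi^r L' <= L holds because pi^r Lambda(M) lies in
    Lambda_r(M). *)
Lemma Lambda_r_stable_ball L : lattice v L ->
  (forall X x, Lambda_r X -> L x -> L (X *m x)) ->
  bolytrope (homothety_class pi L).
Proof.
move=> latL LS; apply/bolytropeP => //; exists (set_mulmx Lambda L).
have L'L x : set_mulmx Lambda L x -> L (pi ^ r *: x).
  case=> n [X [y [LX Ly ->]]]; rewrite scaler_sumr.
  apply: (lattice_sum hpi) => // i; rewrite scalemxAl.
  by apply: LS => //; exact: Lambda_r_scale.
have LL' : L `<=` set_mulmx Lambda L.
  move=> x Lx; exists 1%N, (fun=> 1%:M), (fun=> x).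
  by split=> //; [move=> _; exact: Lambda1|rewrite big_ord1 mul1mx].
have L'S X x : Lambda X -> set_mulmx Lambda L x -> set_mulmx Lambda L (X *m x).
  move=> LX [n [Y [y [LY Ly ->]]]]; exists n, (fun i => X *m Y i), y.
  split=> // [i|]; first exact: LambdaM.
  by rewrite mulmx_sumr; apply: eq_bigr => i _; rewrite mulmxA.
split=> //.
(* Comparing [L] with the lattice spanned by the columns of [P] bounds L' on both sides: it contains
   [L], and pi^r L' <= L accounts for the exponent [m + r]. *)
have latO := lattice_diag hpi (fun=> 0) uP.
have [n On] := lattice_commensurable hpi latO latL.
have [m Om] := lattice_commensurable hpi latL latO.
apply: (@Lambda_stable_lattice _ n (m + r)) => //.
- move=> _ _ [p [X [x [LX Lx ->]]]] [q [Y [y [LY Ly ->]]]].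
  exists (p + q)%N.
  exists (fun i => match split i with inl j => X j | inr j => Y j end).
  exists (fun i => match split i with inl j => x j | inr j => y j end).
  split=> [i|i|]; [by case: split|by case: split|].
  rewrite big_split_ord/=; congr (_ + _); apply: eq_bigr => i _.
    by rewrite -[lshift _ _]/(unsplit (inl i)) unsplitK.
  by rewrite -[rshift _ _]/(unsplit (inr i)) unsplitK.
- by apply: LL'; exact: (lattice0 hpi).
- move=> i; apply: LL'; apply: On => k /=.
  rewrite colE mulKmx// mxE; case: eqP => _; last exact: max_ideal_pow0.
  exact: max_ideal_pow1.
- move=> x /L'L /Om h i; have := h i.
  by rewrite -!scalemxAr !scalemxE mulrA -!exprnP -exprD.
Qed.

Lemma Q_bolytrope_order : Q v pi (PZ v pi bolytrope) = bolytrope.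
Proof.
have Lr1 : PZ v pi bolytrope 1%:M by exact: PZ1.
apply/seteqP; split=> c.
  move=> Qc; have [L latL cE] := Q_building Qc; move: Qc; rewrite -cE.
  move=> /(QP hpi Lr1 latL); rewrite bolytrope_orderE.
  exact: Lambda_r_stable_ball.
move=> Bc; have [[L latL cE] _] := Bc; move: Bc; rewrite -cE => BL.
apply/(QP hpi) => // X x; rewrite bolytrope_orderE => LX.
exact: Lambda_r_stable.
Qed.

(** * Freeness of Lambda_r(M) *)

(** A basis consists of the identity, in place of the elementary matrix at [(i0, i0)], and the
    pi^(M_ij + r) E_ij at all other positions, conjugated back by [P]. The identity carries the
    common residue of the diagonal entries. *)
Lemma free_Lambda_r : free_submodule v (d ^ 2) Lambda_r.
Proof.
have pi0 n : pi ^ n != 0 by exact: (uniformizer_neq0 hpi).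
pose N i j := M i j + r%:Z.
pose b (ij : 'I_d * 'I_d) : 'M[K]_d := P *m
  (if ij == (i0, i0) then 1%:M else pi ^ N ij.1 ij.2 *: delta_mx ij.1 ij.2)
  *m invmx P.
have bE (c : 'I_d * 'I_d -> K) i j : conj (\sum_ij c ij *: b ij) i j =
    c (i0, i0) * (i == j)%:R +
    (if (i, j) == (i0, i0) then 0 else pi ^ N i j * c (i, j)).
  pose c' i j := if (i, j) == (i0, i0) then 0 else pi ^ N i j * c (i, j).
  suff -> : conj (\sum_ij c ij *: b ij) = (c (i0, i0))%:M + \matrix_(i, j) c' i j.
    by rewrite !mxE mulr_natr.
  rewrite [X in _ + X]matrix_sum_delta pair_big/= (bigD1 (i0, i0))//=.
  rewrite [X in _ = _ + X](bigD1 (i0, i0))//=.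
  rewrite mxE /c' eqxx scale0r add0r mulmxDr mulmxDl.
  rewrite /b eqxx mulmx1 mulmxV// -scalemxAr mulmx1 -scalemxAl mulVmx// scalemx1.
  congr (_ + _); rewrite mulmx_sumr mulmx_suml; apply: eq_bigr => -[k l] kl.
  rewrite mxE (negPf kl) -scalemxAr -scalemxAl !mulmxA mulVmx// mul1mx mulmxKV//.
  by rewrite scalerA mulrC.
apply: (@free_submodule_fin _ _ _ _ _ b).
- by rewrite card_prod card_ord mulnn.
- move=> c c0.
  have cE i j : c (i0, i0) * (i == j)%:R +
    (if (i, j) == (i0, i0) then 0 else pi ^ N i j * c (i, j)) = 0.
    by rewrite -bE c0 mulmx0 mul0mx mxE.
  have c00 : c (i0, i0) = 0 by have := cE i0 i0; rewrite !eqxx mulr1 addr0.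
  move=> [i j]; have := cE i j; rewrite c00 mul0r add0r.
  case: eqP => [->//|_] /eqP; rewrite mulf_eq0 (negPf (pi0 _)).
  by move/eqP.
move=> X; split=> [/Lambda_rE[Xii Xij Xd]|[c cO ->]]; last first.
  have {}cO ij : I 0 (c ij) by apply/(valuation_ringE hpi).
  apply/Lambda_rE.
  have diag i : exists2 y, I r%:Z y & conj (\sum_ij c ij *: b ij) i i =
      c (i0, i0) + y.
    rewrite bE eqxx mulr1; eexists; last reflexivity.
    case: eqP => _; first exact: max_ideal_pow0.
    by apply/(max_ideal_pow_mulpi hpi); rewrite /N hM.1 add0r subrr.
  split=> [i|i j ij|i j].
  - have [y Iy ->] := diag i; apply: max_ideal_powD => //.
    exact: max_ideal_pow_le Iy.
  - rewrite bE (negPf ij) mulr0 add0r; case: eqP => _; first exact: max_ideal_pow0.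
    by apply/(max_ideal_pow_mulpi hpi); rewrite subrr.
  - have [y Iy ->] := diag i; have [z Iz ->] := diag j.
    by rewrite opprD addrACA subrr add0r; exact: max_ideal_powB.
(* The coefficient of the identity is the entry at [(i0, i0)]; once this scalar is subtracted, the
   other entries are divisible by their powers of pi. *)
pose c (ij : 'I_d * 'I_d) := if ij == (i0, i0) then conj X i0 i0 else
  pi ^ (- N ij.1 ij.2) *
  (conj X ij.1 ij.2 - conj X i0 i0 * (ij.1 == ij.2)%:R).
exists c => [[i j]|].
  apply/(valuation_ringE hpi); rewrite /c; case: eqP => _; first exact: Xii.
  apply/(max_ideal_pow_mulpi hpi); rewrite sub0r opprK /=.
  have [<-|ij] := eqVneq i j; last by rewrite mulr0 subr0; exact: Xij.
  by rewrite /N hM.1 add0r mulr1.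
suff h : conj X = conj (\sum_ij c ij *: b ij).
  move/(congr1 (fun Y => P *m Y *m invmx P)): h.
  by rewrite !mulmxA !mulmxV// !mul1mx !mulmxK.
apply/matrixP => i j; rewrite bE.
have -> : c (i0, i0) = conj X i0 i0 by rewrite /c eqxx.
case: (eqVneq (i, j) (i0, i0)) => [[-> ->]|ne]; first by rewrite eqxx mulr1 addr0.
rewrite /c (negPf ne) mulrA -expfzDr ?subrr ?mul1r; last first.
  by case: hpi.
by rewrite addrC subrK.
Qed.

End Bolytropes.

Theorem theorem6p6 (K : fieldType) (v : discrete_valuation K) (pi : K)
    (hpi : uniformizer v pi) (d : nat) (hd : (0 < d)%N)
    (e : d.-tuple 'cV[K]_d) (he : basis_of fullv e)
    (M : 'M[int]_d) (hM : polytrope_matrix M) (r : nat) :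
  [/\ Lambda_r v pi e M r = bolytrope_order v pi e M r,
      Q v pi (bolytrope_order v pi e M r) = bolytrope v pi e M r,
      closed_order v pi (bolytrope_order v pi e M r) &
      PZ_closed v pi (bolytrope v pi e M r)].
Proof.
have [P uP eP] := mx_in_basisE he.
have orderE := bolytrope_orderE hpi hd hM r uP eP.
have QE := Q_bolytrope_order hpi hd hM r uP eP.
(* Freeness is read off from Lambda_r(M), closure under products from the intersection of
   endomorphism rings. *)
have ord : is_order v (bolytrope_order v pi e M r).
  split; last exact: PZM; last exact: PZ1.
  by rewrite /bolytrope_order orderE; exact (free_Lambda_r hpi hd hM r uP eP).
(* By [QE], applying [Q] returns the bolytrope, and [PZ] of the bolytrope is the order by
   definition. *)
split=> //; first by split=> //; rewrite QE.
by exists (bolytrope_order v pi e M r).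
Qed.
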